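(* Let $(X,d)$ be a metric space and $A\subset X$ a nonempty closed set. For each $\varphi\in C^*(A)$, let $\Psi[\varphi]:X\to\mathbb{R}$ be the extension of $\varphi$ defined by $\Psi[\varphi](p)=\varphi(p)$ for $p\in A$ and $$\Psi[\varphi](p)=\inf_{a\in A}\left[\varphi(a)+\frac{d(a,p)}{d(p,A)}-1\right],\quad\text{whenever } p\in X\setminus A.$$ Then $\Psi$ is a map from $C^*(A)$ to $C^*(X)$ which is an extension operator and an isotone isometry. Moreover, $\Psi$ preserves both uniform continuity and the constants.
   Context: For a space $Z$, $C^*(Z)$ is the Banach space of all bounded continuous real-valued functions on $Z$ with the sup-norm $\|f\|=\sup_{z\in Z}|f(z)|$, partially ordered pointwise ($f\le g$ iff $f(z)\le g(z)$ for all $z\in Z$). For a metric space $Z$, $C^*_u(Z)$ denotes the set of uniformly continuous members of $C^*(Z)$. Subsets of $X$ carry the restricted metric. $d(p,A)=\inf\{d(p,a):a\in A\}$. For a map $\Psi:C^*(A)\to C^*(X)$: it is an extension operator if $\Psi[\varphi]\upharpoonright A=\varphi$ for every $\varphi\in C^*(A)$; it is isotone if $\varphi\le\psi$ implies $\Psi[\varphi]\le\Psi[\psi]$; it is an isometry if $\|\Psi[\varphi]-\Psi[\psi]\|=\|\varphi-\psi\|$ for all $\varphi,\psi\in C^*(A)$; it preserves uniform continuity if $\Psi[C^*_u(A)]\subset C^*_u(X)$; it preserves the constants if $\Psi[t_A]=t_X$ for every $t\in\mathbb{R}$, where $t_Z:Z\to\{t\}$ denotes the constant function on $Z$ with value $t$.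 Linearity of $\Psi$ is not assumed or claimed. *)

(* Defs.v *)
From HB Require Import structures.
From mathcomp Require Import all_boot all_order all_algebra.
From mathcomp Require Import all_classical all_reals all_analysis.

Set Implicit Arguments.
Unset Strict Implicit.
Unset Printing Implicit Defensive.

Import Order.TTheory GRing.Theory Num.Theory.
Import numFieldNormedType.Exports.

Local Open Scope classical_set_scope.
Local Open Scope ring_scope.

(* The library gives the subtype of a set the restricted balls, but stops at   *)
(* the pseudometric structure; this adds the restricted distance itself.       *)
Section restricted_metric.
Context {R : realType} {X : metricType R} (A : set X).

Let rdist (a b : A) : R := mdist (\val a) (\val b).

Let rdist_ge0 (a b : A) : 0 <= rdist a b.
Proof. exact: mdist_ge0. Qed.

Let rdist_positivity (a b : A) : rdist a b = 0 -> a = b.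
Proof. by move=> /mdist_positivity/val_inj. Qed.

Let ballE_rdist (a : A) (e : R) : ball a e = [set b | rdist a b < e].
Proof.
by rewrite /ball/= /initial_ball/= ballEmdist; apply/seteqP; split.
Qed.

HB.instance Definition _ := @PseudoMetric_isMetric.Build R (set_type A)
  rdist rdist_ge0 rdist_positivity ballE_rdist.

End restricted_metric.

Section bounded_continuous.
Context (R : realType).

Definition Cstar (Z : topologicalType) : set (Z -> R) :=
  [set f | continuous f /\ bounded_fun f].

Definition Cstar_u (Z : metricType R) : set (Z -> R) :=
  @Cstar Z `&` [set f | unif_continuous f].

Definition sup_norm (Z : Type) (f : Z -> R) : R :=
  sup [set `|f z| | z in [set: Z]].

End bounded_continuous.
Arguments Cstar R Z : clear implicits.
Arguments Cstar_u {R} Z.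

(* Maps C^*(A) -> C^*(X) are represented by functions on all of A -> R, so     *)
(* every property below quantifies over C^*(A) only.                           *)
Section operators.
Context {R : realType} {X : metricType R} {A : set X}.
Implicit Type Psi : (A -> R) -> (X -> R).

Definition maps_Cstar Psi := Psi @` Cstar R A `<=` Cstar R X.

Definition extension_operator Psi :=
  forall phi, Cstar R A phi -> sigL A (Psi phi) = phi.

Definition isotone Psi :=
  forall phi psi, Cstar R A phi -> Cstar R A psi ->
    (forall a, phi a <= psi a) -> forall p, Psi phi p <= Psi psi p.

Definition sup_isometry Psi :=
  forall phi psi, Cstar R A phi -> Cstar R A psi ->
    sup_norm (Psi phi \- Psi psi) = sup_norm (phi \- psi).

Definition preserves_unif_continuity Psi := Psi @` Cstar_u A `<=` Cstar_u X.

Definition preserves_constants Psi := forall t : R, Psi (cst t) = cst t.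

End operators.

Definition set_dist {R : realType} {X : metricType R} (p : X) (A : set X) : R :=
  inf [set mdist p a | a in A].

(* [insub p] is [Some a], with [\val a = p], exactly when [p] lies in [A].     *)
Definition Psi_ext {R : realType} {X : metricType R} (A : set X)
    (phi : A -> R) (p : X) : R :=
  if insub p is Some a then phi a
  else inf [set phi a + mdist (\val a) p / set_dist p A - 1 | a in [set: A]].

(* Main.v *)
Require Import Defs.
From mathcomp Require Import all_boot all_order all_algebra.
From mathcomp Require Import all_classical all_reals all_analysis.
From mathcomp Require Import ring lra.

(** Write [u a] for the ratio [mdist a p / set_dist p A].  It is at least 1 and
    comes arbitrarily close to 1, so off [A] the operator is an infimum of
    [phi a] plus a nonnegative penalty [u a - 1] that can be made negligible.

    Order and norm.  The operator is monotone, commutes with the addition of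
    constants and fixes the constants; these three facts alone force
    [`|Psi phi p - Psi psi p| <= c] as soon as [`|phi - psi| <= c] on [A]
    ([Psi_ext_dist_le]), hence boundedness (compare [phi] with 0) and one half
    of the isometry.  The other half holds because the operator extends.

    Continuity.  If [`|phi| <= M], the points [a] with [u a > 2 * M + 2]
    contribute more than [M + 1], so they are irrelevant to the infimum: only
    points with [mdist a p <= (2 * M + 2) * set_dist p A] count.  Two estimates
    follow.  Close to [A] ([Psi_ext_near_in]): if [p] is within [s] of [a0],
    all relevant points are within [(2 * M + 3) * s] of [a0], so the value at
    [p] differs from [phi a0] by at most the oscillation of [phi] there.  Away
    from [A] ([Psi_ext_lipschitz_out]): on the relevant points the ratio varies
    with [p] at a rate of at most [(2 * M + 3) / r] where [set_dist >= r], and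
    a Lipschitz bound passes to the infimum.  Continuity at a point of [A] uses
    the first estimate, continuity at a point off the closed set [A] the
    second.  For uniform continuity the first is applied when one of the two
    points is at distance less than [r] from [A], the second otherwise, with
    [r] fixed by the modulus of [phi]. *)

Set Implicit Arguments.
Unset Strict Implicit.
Unset Printing Implicit Defensive.

Import Order.TTheory GRing.Theory Num.Theory.
Import numFieldNormedType.Exports.

Local Open Scope classical_set_scope.
Local Open Scope ring_scope.

(** * Bounded functions and continuity in terms of the distance *)

Lemma bounded_fun_normP (R : realType) (T : Type) (f : T -> R) :
  bounded_fun f <-> exists M, forall z, `|f z| <= M.
Proof.
split=> [[M [_ fM]]|[M fM]].
  by exists (M + 1) => z; apply: (fM (M + 1)) => //; rewrite ltrDl.
exists M; split; first exact: num_real.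
by move=> N /ltW MN z _ /=; exact: le_trans (fM z) MN.
Qed.

Lemma bounded_fun_sub (R : realType) (T : Type) (f g : T -> R) :
  bounded_fun f -> bounded_fun g -> bounded_fun (f \- g).
Proof.
move=> /bounded_fun_normP[M fM] /bounded_fun_normP[N gN].
apply/bounded_fun_normP; exists (M + N) => z.
by rewrite (le_trans (ler_normB _ _))// lerD.
Qed.

Lemma le_sup_norm (R : realType) (T : Type) (f : T -> R) z :
  bounded_fun f -> `|f z| <= sup_norm f.
Proof.
move=> /bounded_fun_normP[M fM]; apply: ub_le_sup; last by exists z.
by exists M => _ [y _ <-].
Qed.

(** The point [z0] cannot be dropped: the supremum of the empty set is 0, and
    the bound [c] could then be negative. *)
Lemma sup_norm_le (R : realType) (T : Type) (f : T -> R) (z0 : T) c :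
  (forall z, `|f z| <= c) -> sup_norm f <= c.
Proof.
by move=> fc; apply: ge_sup => [|_ [z _ <-]//]; exists `|f z0|, z0.
Qed.

Lemma continuous_at_mdistP (R : realType) (Z : metricType R) (f : Z -> R)
    (x : Z) :
  {for x, continuous f} <-> forall e : R, 0 < e -> exists2 d, 0 < d &
    forall y, mdist x y < d -> `|f x - f y| < e.
Proof.
split=> [/cvgrPdist_lt fx e e0|fx].
  have /nbhs_ballP[d /= d0 fd] := fx e e0.
  by exists d => // y xyd; apply: fd; rewrite ballEmdist.
apply/cvgrPdist_lt => e e0; have [d d0 fd] := fx e e0.
by apply/nbhs_ballP; exists d => // y; rewrite ballEmdist; exact: fd.
Qed.

Lemma unif_continuous_mdistP (R : realType) (Z : metricType R) (f : Z -> R) :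
  unif_continuous f <-> forall e : R, 0 < e -> exists2 d, 0 < d &
    forall x y, mdist x y < d -> `|f x - f y| < e.
Proof.
split=> [fu e e0|fu U].
  have := fu [set xy | ball xy.1 e xy.2].
  rewrite -!entourage_ballE => /(_ _)[|d /= d0 fd]; first by exists e.
  exists d => // x y xyd.
  by have := fd (x, y); rewrite /= ballEmdist; apply.
rewrite -!entourage_ballE => -[e /= e0 eU].
have [d d0 fd] := fu e e0; exists d => //= -[x y] /=.
by rewrite ballEmdist /= => xyd; apply: eU; exact: fd.
Qed.

(** * Distance to a nonempty set *)

Section set_dist_theory.
Context {R : realType} {X : metricType R} {A : set X}.
Hypothesis A_neq0 : A !=set0.
Implicit Types (a : A) (p q : X).

Lemma set_type_inhabited : inhabited A.
Proof. by have [b Ab] := A_neq0; split; exists b; rewrite inE. Qed.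

(** Points of [A] come as points of the subtype, on which the extension is
    given by computation. *)
Lemma set_type_dichotomy p : (exists a, p = \val a) \/ ~ A p.
Proof.
have [Ap|nAp] := pselect (A p); [left|by right].
have Ap' : p \in A by rewrite inE.
by exists (exist _ p Ap').
Qed.

Lemma set_dist_le a p : set_dist p A <= mdist (\val a) p.
Proof.
apply: ge_inf; first by exists 0 => _ [b _ <-]; exact: mdist_ge0.
by exists (\val a); [have := valP a; rewrite inE | exact: metric_sym].
Qed.

Lemma set_dist_near p e : 0 < e ->
  exists a, mdist (\val a) p < set_dist p A + e.
Proof.
move=> e0; have [|_ [b Ab <-] pb] := @inf_adherent _ [set mdist p b | b in A] e e0.
  split; last by exists 0 => _ [b _ <-]; exact: mdist_ge0.
  by have [b Ab] := A_neq0; exists (mdist p b), b.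
have Ab' : b \in A by rewrite inE.
by exists (exist _ b Ab'); rewrite metric_sym.
Qed.

Lemma set_dist_gt0 p : closed A -> ~ A p -> 0 < set_dist p A.
Proof.
move=> A_closed nAp.
have /nbhs_ballP[e /= e0 eA] : nbhs p (~` A).
  by apply: open_nbhs_nbhs; split => //; exact: closed_openC.
apply: (lt_le_trans e0); apply: lb_le_inf => [|_ [b Ab <-]].
  by have [b Ab] := A_neq0; exists (mdist p b), b.
by rewrite leNgt; apply/negP => h; apply: (eA b) => //; rewrite ballEmdist.
Qed.

Lemma set_dist_gt0_notin p : 0 < set_dist p A -> ~ A p.
Proof.
move=> p0; have [[a pa]|//] := set_type_dichotomy p.
by have := set_dist_le a p; rewrite pa mdistxx -pa leNgt p0.
Qed.

Lemma set_dist_lipschitz p q : set_dist q A <= set_dist p A + mdist p q.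
Proof.
apply/ler_addgt0Pr => e /(set_dist_near p)[a ap].
have := set_dist_le a q; have := metric_triangle (\val a) p q; lra.
Qed.

End set_dist_theory.

(** * Order and norm properties of the extension *)

Section Psi_ext_theory.
Context {R : realType} {X : metricType R} {A : set X}.
Hypotheses (A_neq0 : A !=set0) (A_closed : closed A).
Implicit Types (a : A) (p q : X) (phi psi : A -> R) (c e m r s M N : R).

Lemma set_dist_ratio_ge1 a p : ~ A p -> 1 <= mdist (\val a) p / set_dist p A.
Proof.
move=> nAp; rewrite ler_pdivlMr ?mul1r ?set_dist_gt0//.
exact: set_dist_le.
Qed.

Lemma set_dist_ratio_near p e : ~ A p -> 0 < e ->
  exists a, mdist (\val a) p / set_dist p A < 1 + e.
Proof.
move=> nAp e0; have p0 := set_dist_gt0 A_neq0 A_closed nAp.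
have [a ap] := set_dist_near A_neq0 p (mulr_gt0 e0 p0).
by exists a; rewrite ltr_pdivrMr// mulrDl mul1r.
Qed.

Lemma Psi_ext_val phi a : Psi_ext phi (\val a) = phi a.
Proof. by rewrite /Psi_ext valK. Qed.

(** A lower bound of [phi] is what makes the infimum a genuine one. *)
Lemma Psi_ext_le phi m p a : (forall b, m <= phi b) -> ~ A p ->
  Psi_ext phi p <= phi a + mdist (\val a) p / set_dist p A - 1.
Proof.
move=> phi_ge nAp; rewrite /Psi_ext insubN ?notin_setE//.
apply: ge_inf; last by exists a.
exists m => _ [b _ <-].
by have := phi_ge b; have := set_dist_ratio_ge1 b nAp; lra.
Qed.

Lemma Psi_ext_ge phi c p : ~ A p ->
  (forall a, c <= phi a + mdist (\val a) p / set_dist p A - 1) ->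
  c <= Psi_ext phi p.
Proof.
move=> nAp c_le; rewrite /Psi_ext insubN ?notin_setE//.
apply: lb_le_inf => [|_ [a _ <-]//].
by have [a] := set_type_inhabited A_neq0; eexists; exists a.
Qed.

(** Monotonicity and invariance under the addition of a constant, in one
    statement. *)
Lemma Psi_ext_le_translate phi psi m c p : (forall a, m <= phi a) ->
  (forall a, phi a <= psi a + c) -> Psi_ext phi p <= Psi_ext psi p + c.
Proof.
move=> phi_ge phi_le; have [[a ->]|nAp] := set_type_dichotomy (A := A) p.
  by rewrite !Psi_ext_val.
rewrite -lerBlDr; apply: Psi_ext_ge => // a.
by have := Psi_ext_le a phi_ge nAp; have := phi_le a; lra.
Qed.

Lemma Psi_ext_cst (t : R) : Psi_ext (cst t : A -> R) = cst t.
Proof.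
apply/funext => p; have [[a ->]|nAp] := set_type_dichotomy (A := A) p.
  by rewrite Psi_ext_val.
apply/eqP; rewrite eq_le; apply/andP; split.
  apply/ler_addgt0Pr => e e0; have [a ap] := set_dist_ratio_near nAp e0.
  have := @Psi_ext_le (cst t) t p a (fun=> lexx t) nAp.
  by rewrite /cst; lra.
apply: Psi_ext_ge => // a.
by have := set_dist_ratio_ge1 a nAp; rewrite /cst; lra.
Qed.

Lemma Psi_ext_dist_le phi psi M N c p :
  (forall a, `|phi a| <= M) -> (forall a, `|psi a| <= N) ->
  (forall a, `|phi a - psi a| <= c) -> `|Psi_ext phi p - Psi_ext psi p| <= c.
Proof.
move=> phiM psiN phipsi.
have phi_ge a : - M <= phi a by have := phiM a; rewrite ler_norml => /andP[].
have psi_ge a : - N <= psi a by have := psiN a; rewrite ler_norml => /andP[].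
have : Psi_ext phi p <= Psi_ext psi p + c.
  apply: Psi_ext_le_translate phi_ge _ => a.
  by have := phipsi a; rewrite ler_norml => /andP[]; lra.
have : Psi_ext psi p <= Psi_ext phi p + c.
  apply: Psi_ext_le_translate psi_ge _ => a.
  by have := phipsi a; rewrite ler_norml => /andP[]; lra.
by rewrite ler_norml; lra.
Qed.

Lemma Psi_ext_norm_le phi M p :
  (forall a, `|phi a| <= M) -> `|Psi_ext phi p| <= M.
Proof.
move=> phiM; have := @Psi_ext_dist_le phi (cst 0) M 0 M p phiM.
rewrite Psi_ext_cst /cst subr0; apply => a; first by rewrite normr0.
by rewrite subr0.
Qed.

(** * Continuity and uniform continuity of the extension *)

(** The points relevant to the infimum at [p] are within
    [(2 * M + 2) * set_dist p A] of [p], hence within [(2 * M + 3) * s] of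
    [a0], where [e] bounds the oscillation of [phi].  The statement covers
    [p] in [A] so that its users need not distinguish cases. *)
Lemma Psi_ext_near_in phi M e s p a0 : (forall a, `|phi a| <= M) ->
  mdist (\val a0) p < s ->
  (forall a, mdist (\val a) (\val a0) < (2 * M + 3) * s ->
    `|phi a - phi a0| <= e) ->
  `|Psi_ext phi p - phi a0| <= e.
Proof.
move=> phiM a0p osc.
have s0 : 0 < s by exact: le_lt_trans (mdist_ge0 _ _) a0p.
have M0 : 0 <= M by exact: le_trans (normr_ge0 _) (phiM a0).
have e0 : 0 <= e.
  have := osc a0; rewrite mdistxx subrr normr0; apply.
  by apply: mulr_gt0 => //; lra.
have [[a pE]|nAp] := set_type_dichotomy (A := A) p.
  by move: a0p; rewrite pE Psi_ext_val metric_sym => a0p; apply: osc; nra.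
have d0 := set_dist_gt0 A_neq0 A_closed nAp.
have dlt : set_dist p A < s := le_lt_trans (set_dist_le a0 p) a0p.
have near a : mdist (\val a) p / set_dist p A <= 2 * M + 2 ->
    phi a0 - e <= phi a <= phi a0 + e.
  rewrite ler_pdivrMr// => h.
  have : `|phi a - phi a0| <= e.
    apply: osc; have := metric_triangle (\val a) p (\val a0).
    by rewrite [mdist p _]metric_sym; nra.
  by rewrite ler_norml => /andP[]; lra.
have phi_ge a : - M <= phi a by have := phiM a; rewrite ler_norml => /andP[].
rewrite ler_norml; apply/andP; split; rewrite ?lerBrDr ?lerBlDr.
  apply: Psi_ext_ge => // a.
  have [/near /andP[+ _]|] := leP (mdist (\val a) p / set_dist p A) (2 * M + 2).
    by have := set_dist_ratio_ge1 a nAp; lra.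
  by have := phi_ge a; have := phiM a0; rewrite ler_norml => /andP[]; lra.
apply/ler_addgt0Pr => x x0.
(* a near-minimizer of the ratio is relevant once the ratio is at most 2 *)
have y0 : 0 < Num.min x 1 by rewrite lt_min x0 ltr01.
have [a ap] := set_dist_ratio_near nAp y0.
have [yx y1] : Num.min x 1 <= x /\ Num.min x 1 <= 1.
  by split; rewrite ge_min lexx ?orbT.
have /andP[_ h] : phi a0 - e <= phi a <= phi a0 + e by apply: near; lra.
by have := Psi_ext_le a phi_ge nAp; lra.
Qed.

(** With [u = mdist a p / set_dist p A], moving from [p] to [q] raises the
    ratio by at most [(1 + u) * mdist p q / set_dist q A]: the numerator grows
    and the denominator shrinks by at most [mdist p q].  The relevant points
    have [u <= 2 * M + 2]. *)
Lemma Psi_ext_lipschitz_out phi M r p q : (forall a, `|phi a| <= M) ->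
  0 < r -> r <= set_dist p A -> r <= set_dist q A ->
  `|Psi_ext phi p - Psi_ext phi q| <= (2 * M + 3) * mdist p q / r.
Proof.
move=> phiM r0; wlog suff H : p q / r <= set_dist p A -> r <= set_dist q A ->
    Psi_ext phi q <= Psi_ext phi p + (2 * M + 3) * mdist p q / r.
  move=> rp rq; have := H p q rp rq.
  by have := H q p rq rp; rewrite [mdist q p]metric_sym ler_norml; lra.
move=> rp rq; have p0 := lt_le_trans r0 rp; have q0 := lt_le_trans r0 rq.
rewrite -lerBlDr; apply: Psi_ext_ge => [|a]; first exact: set_dist_gt0_notin.
have phi_ge b : - M <= phi b by have := phiM b; rewrite ler_norml => /andP[].
have M0 : 0 <= M by exact: le_trans (normr_ge0 _) (phiM a).
have d0 : 0 <= (2 * M + 3) * mdist p q by rewrite mulr_ge0 ?mdist_ge0//; lra.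
set u := mdist (\val a) p / set_dist p A.
have [uK|uK] := leP u (2 * M + 2); last first.
  have : 0 <= (2 * M + 3) * mdist p q / r by rewrite divr_ge0 ?(ltW r0).
  have := Psi_ext_norm_le q phiM; have := phi_ge a.
  by rewrite ler_norml => ? /andP[]; lra.
have := Psi_ext_le a phi_ge (set_dist_gt0_notin q0).
suff : mdist (\val a) q / set_dist q A <=
    u + (2 * M + 3) * mdist p q / set_dist q A.
  have : (2 * M + 3) * mdist p q / set_dist q A <= (2 * M + 3) * mdist p q / r.
    by rewrite ler_wpM2l ?lef_pV2 ?posrE.
  lra.
rewrite ler_pdivrMr// mulrDl divfK ?gt_eqF//.
have ua : mdist (\val a) p = u * set_dist p A by rewrite /u divfK ?gt_eqF.
have := metric_triangle (\val a) p q; rewrite ua.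
have := set_dist_lipschitz A_neq0 q p; rewrite [mdist q p]metric_sym.
have u1 : 1 <= u by apply: set_dist_ratio_ge1; exact: set_dist_gt0_notin.
by have := mdist_ge0 p q; nra.
Qed.

Lemma Psi_ext_unif_cont_out phi M r e p q : (forall a, `|phi a| <= M) ->
  0 < r -> r <= set_dist p A -> r <= set_dist q A ->
  mdist p q < e * r / (2 * M + 3) -> `|Psi_ext phi p - Psi_ext phi q| < e.
Proof.
move=> phiM r0 rp rq.
have [a] := set_type_inhabited A_neq0.
have M0 : 0 <= M by exact: le_trans (normr_ge0 _) (phiM a).
rewrite ltr_pdivlMr => [pq|]; last by lra.
apply: le_lt_trans (Psi_ext_lipschitz_out phiM r0 rp rq) _.
by rewrite ltr_pdivrMr// mulrC.
Qed.

Lemma Psi_ext_continuous phi M : (forall a, `|phi a| <= M) ->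
  continuous phi -> continuous (Psi_ext phi).
Proof.
move=> phiM phi_cont p; apply/continuous_at_mdistP => e e0.
have K0 : 0 < 2 * M + 3.
  have [b] := set_type_inhabited A_neq0.
  by have := le_trans (normr_ge0 _) (phiM b); lra.
have [[a ->]|nAp] := set_type_dichotomy (A := A) p.
  have e20 : 0 < e / 2 by rewrite divr_gt0.
  have [d d0 phid] := (continuous_at_mdistP _ _).1 (phi_cont a) _ e20.
  exists (d / (2 * M + 3)) => [|q aq]; first by rewrite divr_gt0.
  rewrite Psi_ext_val distrC; apply: (@le_lt_trans _ _ (e / 2)); last by lra.
  apply: Psi_ext_near_in phiM aq _ => b.
  rewrite [_ * (d / _)]mulrC divfK ?gt_eqF// metric_sym distrC => h.
  exact/ltW/phid.
(* points within [r] of [p] are still at distance at least [r] from [A] *)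
have p0 := set_dist_gt0 A_neq0 A_closed nAp.
set r := set_dist p A / 2.
have r0 : 0 < r by rewrite divr_gt0.
exists (Num.min r (e * r / (2 * M + 3))) => [|q].
  by rewrite lt_min r0 divr_gt0 ?mulr_gt0.
rewrite lt_min => /andP[pqr]; apply: Psi_ext_unif_cont_out => //.
  by rewrite /r; lra.
have := set_dist_lipschitz A_neq0 q p; rewrite [mdist q p]metric_sym.
by move: pqr; rewrite /r; lra.
Qed.

Lemma Psi_ext_unif_continuous phi M : (forall a, `|phi a| <= M) ->
  unif_continuous phi -> unif_continuous (Psi_ext phi).
Proof.
move=> phiM /unif_continuous_mdistP phi_uc; apply/unif_continuous_mdistP => e e0.
have e30 : 0 < e / 3 by rewrite divr_gt0.
have [d d0 phid] := phi_uc _ e30.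
have K0 : 0 < 2 * M + 3.
  have [b] := set_type_inhabited A_neq0.
  by have := le_trans (normr_ge0 _) (phiM b); lra.
(* a point within [r] of [A], and any point within [r] of it, are both within
   [2 * r] of one point of [A]; the radius of [Psi_ext_near_in] is then [d] *)
set r := d / (2 * M + 3) / 2.
have r0 : 0 < r by rewrite !divr_gt0.
have rE : (2 * M + 3) * (2 * r) = d by rewrite /r; field; rewrite gt_eqF.
exists (Num.min r (e * r / (2 * M + 3))) => [|p q].
  by rewrite lt_min r0; apply: divr_gt0 => //; exact: mulr_gt0.
rewrite lt_min => /andP[pqr pqe].
have close x y : set_dist x A < r -> mdist x y < r ->
    `|Psi_ext phi x - Psi_ext phi y| < e.
  move=> xr xyr; have rx0 : 0 < r - set_dist x A by lra.
  have [a] := set_dist_near A_neq0 x rx0; rewrite addrC subrK => ax.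
  have ax2 : mdist (\val a) x < 2 * r by lra.
  have ay2 : mdist (\val a) y < 2 * r.
    by have := metric_triangle (\val a) x y; lra.
  have osc b : mdist (\val b) (\val a) < (2 * M + 3) * (2 * r) ->
    `|phi b - phi a| <= e / 3 by rewrite rE => h; exact/ltW/phid.
  have := Psi_ext_near_in phiM ax2 osc; have := Psi_ext_near_in phiM ay2 osc.
  by rewrite !ler_norml ltr_norml => /andP[? ?] /andP[? ?]; apply/andP; split; lra.
have [pr|rp] := ltP (set_dist p A) r; first exact: close.
have [qr|rq] := ltP (set_dist q A) r.
  by rewrite distrC; apply: close; rewrite // metric_sym.
exact: Psi_ext_unif_cont_out pqe.
Qed.

Lemma Psi_ext_Cstar phi : Cstar R A phi -> Cstar R X (Psi_ext phi).
Proof.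
move=> [phi_cont /bounded_fun_normP[M phiM]]; split.
  exact: (Psi_ext_continuous phiM phi_cont).
by apply/bounded_fun_normP; exists M => p; exact: Psi_ext_norm_le.
Qed.

Lemma Psi_ext_sup_isometry phi psi : Cstar R A phi -> Cstar R A psi ->
  sup_norm (Psi_ext phi \- Psi_ext psi) = sup_norm (phi \- psi).
Proof.
move=> Cphi Cpsi; have [a0] := set_type_inhabited A_neq0.
have [[_ phi_bd] [_ psi_bd]] := (Cphi, Cpsi).
have [_ ext_phi_bd] := Psi_ext_Cstar Cphi.
have [_ ext_psi_bd] := Psi_ext_Cstar Cpsi.
have [M phiM] := (bounded_fun_normP phi).1 phi_bd.
have [N psiN] := (bounded_fun_normP psi).1 psi_bd.
apply/eqP; rewrite eq_le; apply/andP; split.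
  apply: (sup_norm_le (\val a0)) => p; apply: Psi_ext_dist_le phiM psiN _ => a.
  exact: le_sup_norm (bounded_fun_sub phi_bd psi_bd).
apply: (sup_norm_le a0) => a.
have := le_sup_norm (\val a) (bounded_fun_sub ext_phi_bd ext_psi_bd).
by rewrite /= !Psi_ext_val.
Qed.

End Psi_ext_theory.

Theorem theorem2p1 (R : realType) (X : metricType R) (A : set X)
    (A_neq0 : A !=set0) (A_closed : closed A) :
  maps_Cstar (@Psi_ext R X A) /\
  extension_operator (@Psi_ext R X A) /\
  isotone (@Psi_ext R X A) /\
  sup_isometry (@Psi_ext R X A) /\
  preserves_unif_continuity (@Psi_ext R X A) /\
  preserves_constants (@Psi_ext R X A).
Proof.
split; first by move=> _ [phi Cphi <-]; exact: Psi_ext_Cstar.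
split; first by move=> phi _; apply/funext => a; exact: Psi_ext_val.
split.
  move=> phi psi [_ /bounded_fun_normP[M phiM]] _ le_phi_psi p.
  have phi_ge a : - M <= phi a by have := phiM a; rewrite ler_norml => /andP[].
  rewrite -[leRHS]addr0; apply: (Psi_ext_le_translate _ _ _ phi_ge) => // a.
  by rewrite addr0.
split; first by move=> phi psi; exact: Psi_ext_sup_isometry.
split; last exact: Psi_ext_cst.
move=> _ [phi [Cphi phi_uc] <-]; split; first exact: Psi_ext_Cstar.
have [_ /bounded_fun_normP[M phiM]] := Cphi.
exact: Psi_ext_unif_continuous phiM phi_uc.
Qed.
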